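(* Let $T$ be a tree with $n$ vertices, $n\geq 3$, and $t$ end vertices (vertices of degree $1$). If $w$ is a normalised weight function on the edges of $T$, then $$\mathrm{avec}(T,w)\geq \frac{(n-1)(n+t)}{nt}.$$ Equality holds if and only if every end edge of $T$ has weight $\frac{n-1}{t}$ and all the other edges of $T$ have weight $0$.
   Context: Graphs are finite and simple. For a connected graph $G$ with $n$ vertices and $m$ edges, a weight function is a map $w:E(G)\to\mathbb{R}^{\geq 0}$; it is called normalised if $\sum_{e\in E(G)}w(e)=m$ (so for a tree on $n$ vertices the total weight is $n-1$). The weighted distance $d_w(u,v)$ is the minimum, over all paths between $u$ and $v$ in $G$, of the sum of the weights of the edges of the path. The weighted eccentricity of a vertex $v$ is $e_w(v)=\max_{u\in V(G)}d_w(u,v)$, and the average eccentricity is $\mathrm{avec}(G,w)=\frac1n\sum_{v\in V(G)}e_w(v)$. An end vertex (leaf) of a tree is a vertex of degree $1$; an end edge is an edge incident with a leaf. *)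

(* Defs.v *)
From mathcomp Require Import all_boot all_order all_algebra.
From mathcomp Require Import reals.

Set Implicit Arguments.
Unset Strict Implicit.
Unset Printing Implicit Defensive.

Import Order.TTheory GRing.Theory Num.Theory.
Local Open Scope ring_scope.

Section Graphs.

Variables (V : finType) (e : rel V).

Definition simple_graph : Prop := symmetric e /\ irreflexive e.

Definition connected_graph : Prop := forall x y : V, connect e x y.

(* For symmetric e, a ucycle of length 1 or 2 is a loop or an edge traversed
   back and forth, so graph cycles are the ucycles of length at least 3. *)
Definition acyclic : Prop := forall c : seq V, ucycle e c -> (size c < 3)%N.

Definition tree : Prop := [/\ simple_graph, connected_graph & acyclic].

Definition edges : {set {set V}} := [set [set x; y] | x in V, y in V & e x y].

Definition degree (x : V) : nat := #|[set y | e x y]|.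

Definition end_vertices : {set V} := [set x | degree x == 1%N].

Definition end_edges : {set {set V}} :=
  [set f in edges | [exists x in end_vertices, x \in f]].

(* A path u = x_0, x_1, ..., x_k = v is represented by [:: x_1; ...; x_k].
   Its vertices are distinct, so k < #|V| and the length bound of the bseq
   excludes no path. *)
Definition simple_paths (u v : V) : {set #|V|.-bseq V} :=
  [set p : #|V|.-bseq V | [&& path e u p, last u p == v & uniq (u :: p)]].

Section Weights.

Variable R : realType.

(* Only the values of w on edges are meaningful: every definition below
   evaluates w at edges only. *)
Variable w : {set V} -> R.

Definition weight_function : Prop := forall f, f \in edges -> 0 <= w f.

Definition normalised : Prop := \sum_(f in edges) w f = #|edges|%:R.

Definition path_weight (u : V) (p : seq V) : R :=
  \sum_(f <- pairmap (fun x y => [set x; y]) u p) w f.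

(* Starting the iterated minimum at the head of the list makes it the minimum
   of the list whenever there is a path from u to v. *)
Definition wdist (u v : V) : R :=
  let ws := [seq path_weight u p | p : #|V|.-bseq V in simple_paths u v] in
  \big[Num.min/head 0 ws]_(x <- ws) x.

(* Likewise, the iterated maximum starts at one of the values it ranges over. *)
Definition wecc (v : V) : R := \big[Num.max/wdist v v]_(u : V) wdist u v.

Definition avec : R := #|V|%:R^-1 * \sum_(v : V) wecc v.

End Weights.

End Graphs.

(* Main.v *)
Require Import Defs.
From mathcomp Require Import all_boot all_order all_algebra.
From mathcomp Require Import reals.
From mathcomp Require Import ring lra.

Set Implicit Arguments.
Unset Strict Implicit.
Unset Printing Implicit Defensive.

Import Order.TTheory GRing.Theory Num.Theory.
Local Open Scope ring_scope.

(** Write W = n - 1 for the total weight (a tree has n - 1 edges) and c = W/t.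
    Everything rests on one bound: the weighted distance between u and v is at
    least the total weight of the edges whose removal separates u from v
    ([wdist_ge_cut]).  Removing an edge leaves at least one leaf on each of its
    two sides ([edge_separates]), which is used twice.

    - For any vertex v, each edge separates v from some leaf, so the distances
      from the t leaves to v add up to at least W ([sum_wdist_leaves_ge]);
      hence the eccentricity of v is at least c.
    - Arrange the leaves in a cycle, in any order.  Each edge separates at
      least two pairs of consecutive leaves, since the cycle must leave and
      re-enter each side.  So the distances between consecutive leaves, and
      a fortiori the eccentricities of the leaves, add up to at least 2W
      ([sum_wecc_leaves_ge]).

    Using the first bound at the n - t inner vertices and the second at the
    leaves, the eccentricities add up to at least
    (n - t) c + 2W = c (n + t), which is the inequality.

    In the case of equality every inner vertex has eccentricity exactly c.  For
    the neighbour u of a leaf l, the t distances to u are at most c and add up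
    to at least W = t c, so they all equal c, and the end edge at l weighs at
    least c.  The (at least t) end edges then use up the whole weight W, so
    they weigh exactly c and all other edges weigh 0.

    Conversely, for these weights a path costs at most c for each of its
    endpoints that is a leaf, because the interior vertices of a path are not
    leaves ([path_weight_le]).  So the eccentricity is at most c at an inner
    vertex and at most 2c at a leaf, which gives the reverse inequality. *)

(** * Separation by an edge, leaves, and the number of edges of a tree *)

Section TreeCombinatorics.

Variables (V : finType) (e : rel V).

(** The graph [e] with the edge [f] removed.  Two vertices are separated by [f]
    when they are not connected in [cut f]. *)
Definition cut (f : {set V}) : rel V :=
  [rel x y | e x y && ([set x; y] != f)].

Lemma edge_in_edges x y : e x y -> [set x; y] \in edges e.
Proof. by move=> exy; apply/imset2P; exists x y; rewrite ?inE. Qed.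

Lemma edgesP f : f \in edges e -> exists x y, e x y /\ f = [set x; y].
Proof. by case/imset2P=> x y _; rewrite inE => /andP[_ exy] ->; exists x, y. Qed.

(** A walk between two vertices separated by [f] runs through [f]. *)
Lemma path_cross f u p :
  path e u p -> ~~ connect (cut f) u (last u p) ->
  f \in pairmap (fun x y => [set x; y]) u p.
Proof.
elim: p u => [|x p IH] u /=; first by rewrite connect0.
case/andP=> eux px nc; rewrite inE.
have [//|/= nf] := eqVneq f [set u; x].
apply: IH => //; apply: contra nc; apply: connect_trans.
by apply: connect1; rewrite /cut /= eux eq_sym.
Qed.

Hypothesis e_tree : tree e.

Let e_sym : symmetric e. Proof. by case: e_tree => [[]]. Qed.
Let e_irr : irreflexive e. Proof. by case: e_tree => [[]]. Qed.
Let e_conn x y : connect e x y. Proof. by case: e_tree. Qed.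

Lemma cut_sym f : connect_sym (cut f).
Proof. by apply: sym_connect_sym => x y; rewrite /cut /= e_sym setUC. Qed.

Lemma edge_neq x y : e x y -> x != y.
Proof. by apply: contraTneq => ->; rewrite e_irr. Qed.

(** Acyclicity: a simple path from [x] to [y] that avoids the edge [xy] would
    close up to a cycle with it. *)
Lemma edge_bridge x y : e x y -> ~~ connect (cut [set x; y]) x y.
Proof.
move=> exy; apply/negP => /connectP[p0 pp0 lp0].
move: pp0 lp0 => /shortenP[p pp up _] lp.
have pe : path e x p by apply: sub_path pp => a b /andP[].
case: e_tree => _ _ /(_ (x :: p)).
rewrite /ucycle /= rcons_path pe -lp e_sym exy /=.
move: up => /= -> /(_ isT).
case: p pp lp {pe} => [|z [|z' p]] //=.
  by move=> _ lp; move: exy; rewrite lp e_irr.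
by move=> /andP[/andP[_ nz] _] lp; rewrite lp eqxx in nz.
Qed.

(** The path [z :: q :: s] is written from its growing end [z].  If [z] is not a
    leaf, it has a neighbour other than [q]; this neighbour is not on the path
    since there are no cycles, so the path can be extended.  As [y] stays behind
    the growing end, no edge added to the path contains [y], hence none is [f]. *)
Lemma leaf_from (f : {set V}) y z q s :
  y \in f -> path e z (q :: s) -> uniq (z :: q :: s) -> y \in q :: s ->
  exists2 l, l \in end_vertices e & connect (cut f) z l.
Proof.
move=> yf; move: {2}(#|V| - size s)%N (leqnn (#|V| - size s)) => k.
elim: k z q s => [|k IH] z q s.
  rewrite leqn0 subn_eq0 => le _ uzs _.
  have := max_card (mem (z :: q :: s)); rewrite (card_uniqP uzs) /= => /leq_trans/(_ le).
  by rewrite -addn2 -[X in (_ <= X)%N]addn0 leq_add2l.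
move=> le pz uz ys.
have [dz|] := eqVneq (degree e z) 1%N; first by exists z; rewrite ?inE ?dz ?connect0.
have ezq : e z q by case/andP: pz.
move=> dz.
(* A vertex other than a leaf that has a neighbour q has a second one. *)
have [r ezr rq] : exists2 r, e z r & r != q.
  apply/exists_inP; apply: contraNT dz => /exists_inPn nr.
  rewrite /degree (_ : [set _ | _] = [set q]) ?cards1 //.
  apply/setP=> r; rewrite !inE; apply/idP/eqP => [ezr|->//].
  by apply/eqP; have := nr r ezr; rewrite negbK.
have rz : r != z by rewrite eq_sym edge_neq.
have rs : r \notin s.
  (* Otherwise the path closes up to a cycle through z, q and r. *)
  apply/negP => /splitPr rs; case: rs pz uz {le ys} => s1 s2 pz uz.
  case: e_tree => _ _ /(_ (z :: q :: rcons s1 r)).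
  rewrite /ucycle; case: (_ && _) / andP => [_ /(_ isT)|[]].
    by rewrite /= size_rcons.
  have E : z :: q :: s1 ++ r :: s2 = (z :: q :: rcons s1 r) ++ s2.
    by rewrite /= cat_rcons.
  split; last by move: uz; rewrite E cat_uniq => /andP[].
  move: pz; rewrite -cat_rcons -cat_cons cat_path => /andP[pz _].
  by rewrite (cycle_path z) /= last_rcons e_sym ezr.
have yz : y != z by apply: contraTneq ys => ->; case/andP: uz.
have yrz : y \in z :: q :: s by rewrite inE ys orbT.
have ur : uniq (r :: z :: q :: s) by rewrite /= !inE (negPf rz) (negPf rq) (negPf rs).
case: (IH r z (q :: s)) => //.
- rewrite /= ; apply: (@leq_trans (#|V| - size s).-1); last by case: (_ - _)%N le.
  by rewrite subnS.
- by rewrite /= e_sym ezr.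
move=> l ll rl; exists l => //; apply: connect_trans rl; apply: connect1.
rewrite /cut /= ezr /=; apply: contraTneq yf => <-; rewrite !inE (negPf yz).
by apply: contraTneq yrz => ->; case/andP: ur.
Qed.

(** Grow the path from [y] to [x] beyond [x]. *)
Lemma leaf_on_side x y : e x y ->
  exists2 l, l \in end_vertices e & connect (cut [set x; y]) x l.
Proof.
move=> exy; apply: (@leaf_from _ y x y [::]); rewrite ?inE ?eqxx ?orbT //=.
  by rewrite exy.
by rewrite inE edge_neq.
Qed.

Lemma edge_separates f : f \in edges e ->
  exists l1 l2, [/\ l1 \in end_vertices e, l2 \in end_vertices e
                  & ~~ connect (cut f) l1 l2].
Proof.
case/edgesP=> x [y [exy ->]].
have [l1 h1 c1] := leaf_on_side exy.
have eyx : e y x by rewrite e_sym.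
have [l2 h2] := leaf_on_side eyx; rewrite setUC => c2.
exists l1, l2; split=> //; apply: contra (edge_bridge exy) => c12.
by apply: connect_trans c1 (connect_trans c12 _); rewrite cut_sym.
Qed.

Lemma edge_separates_from f v : f \in edges e ->
  exists2 l, l \in end_vertices e & ~~ connect (cut f) v l.
Proof.
case/edge_separates=> l1 [l2 [h1 h2 n12]].
have [c1|] := boolP (connect (cut f) v l1); last by exists l1.
exists l2 => //; apply: contra n12; apply: connect_trans.
by rewrite cut_sym.
Qed.

(** The first step [y] of a simple path from [v] to [r]: the rest of the path
    avoids [v], so it survives the removal of any edge at [v]. *)
Lemma first_step r v : v != r ->
  exists y, e v y && [forall b, connect (cut [set v; b]) y r].
Proof.
move=> vr; have /connectP[p0 pp0 rE] := e_conn v r.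
move: pp0 rE => /shortenP[[|y p] pp up _] /= rE.
  by rewrite rE eqxx in vr.
case/andP: pp => evy pp; exists y; rewrite evy /=; apply/forallP => b.
apply/connectP; exists p => //; move: up => /andP[vp _].
elim: p y {evy rE} pp vp => [//|z p IH] y /= /andP[eyz pp].
rewrite inE negb_or => /andP[vy vp]; rewrite /= IH // andbT /cut /= eyz /=.
rewrite inE negb_or in vp; case/andP: (vp) => vz _.
apply/eqP => /setP/(_ v); rewrite !inE eqxx (negPf vy) (negPf vz) //.
Qed.

(** Fix a root [r].  Sending a vertex [v] other than [r] to the edge from [v] to
    its parent, the first vertex on the way to [r], is a bijection onto the
    edges. *)
Lemma card_edges : #|edges e| = #|V|.-1.
Proof.
have [r _|V0] := pickP V; last first.
  have E : #|V| = 0%N by apply: eq_card0.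
  rewrite E; apply: eq_card0 => f; apply/negP => /edgesP[x _].
  by have := V0 x.
have [par parP] : exists par : V -> V, forall v, v != r ->
    e v (par v) /\ forall b, connect (cut [set v; b]) (par v) r.
  exists (fun v => odflt v
    [pick y | e v y && [forall b, connect (cut [set v; b]) y r]]) => v vr.
  case: pickP => [y /andP[? /forallP]//|n].
  by have [y] := first_step vr; rewrite n.
rewrite -(cardC1 r) -(card_in_imset (f := fun v => [set v; par v])).
  apply: eq_card => f; apply/idP/imsetP => [/edgesP[x [y [exy ->]]]|[v]]; last first.
    by rewrite inE => /parP[evp _] ->; apply: edge_in_edges.
  (* Surjectivity: an edge is the parent edge of its endpoint cut off from r. *)
  have main a b : e a b -> ~~ connect (cut [set a; b]) a r ->
      exists2 v, v \in predC1 r & [set a; b] = [set v; par v].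
    move=> eab nar; exists a.
      by rewrite inE; apply: contraNneq nar => ->; rewrite connect0.
    have ar : a != r by apply: contraNneq nar => ->; rewrite connect0.
    have [eap /(_ b) cp] := parP _ ar.
    have [->//|pb] := eqVneq (par a) b.
    case/negP: nar; apply: connect_trans cp; apply: connect1.
    rewrite /cut /= eap /=; apply: contraNneq pb => /setP/(_ (par a)).
    by rewrite !inE eqxx orbT [par a == a]eq_sym (negPf (edge_neq eap)) => /esym.
  have [cx|] := boolP (connect (cut [set x; y]) x r); last exact: main.
  rewrite setUC; apply: main; first by rewrite e_sym.
  apply: contra (edge_bridge exy); rewrite [[set y; x]]setUC => cy.
  by apply: connect_trans cx _; rewrite cut_sym.
(* Injectivity: v and u would be each other's parent, and both would still be
   connected to r without the edge between them. *)
move=> v u; rewrite !inE => vr ur E.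
have [evp cv] := parP _ vr; have [eup cu] := parP _ ur.
have [//|vu] := eqVneq v u.
have vE : v = par u.
  have : v \in [set u; par u] by rewrite -E set21.
  by case/set2P=> // vu'; rewrite vu' eqxx in vu.
have uE : u = par v.
  have : u \in [set v; par v] by rewrite E set21.
  by case/set2P=> // uv; rewrite uv eqxx in vu.
have := edge_bridge evp; rewrite -uE; case/negP.
have := cv u; rewrite -uE => cur; have := cu v; rewrite -vE setUC => cvr.
by apply: connect_trans cvr _; rewrite cut_sym.
Qed.

Lemma leaf_neighbour l x y : l \in end_vertices e -> e l x -> e l y -> x = y.
Proof.
rewrite inE => /cards1P[z /setP E] lx ly.
by have := E x; have := E y; rewrite !inE lx ly => /esym/eqP -> /esym/eqP.
Qed.

(** Two adjacent leaves would form a whole connected component. *)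
Lemma neighbour_of_leaf l u : (3 <= #|V|)%N ->
  l \in end_vertices e -> e l u -> u \notin end_vertices e.
Proof.
move=> V3 ll elu; apply/negP => lu.
have cl : closed e (mem [set l; u]).
  apply: intro_closed; first exact: sym_connect_sym.
  move=> x y exy; rewrite !inE => /orP[]/eqP xE; rewrite xE in exy.
    by rewrite (leaf_neighbour ll exy elu) eqxx orbT.
  by rewrite e_sym in elu; rewrite (leaf_neighbour lu exy elu) eqxx.
have : (#|V| <= #|[set l; u]|)%N.
  apply: subset_leq_card; apply/subsetP => x _.
  by rewrite -(closed_connect cl (e_conn l x)) !inE eqxx.
by rewrite cards2 => /(leq_trans V3); case: (_ != _).
Qed.

Lemma leaf_edge l : l \in end_vertices e -> exists u, e l u.
Proof. by rewrite inE => /cards1P[z /setP/(_ z)]; rewrite !inE eqxx; exists z. Qed.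

End TreeCombinatorics.

(** On the cyclic sequence [s], a predicate that holds somewhere but not
    everywhere is lost at some step. *)
Lemma exit_next (T : eqType) (s : seq T) (P : pred T) x y :
  uniq s -> x \in s -> y \in s -> P x -> ~~ P y ->
  exists2 z, z \in s & P z && ~~ P (next s z).
Proof.
move=> us xs ys Px; have [i s' E] := rot_to xs.
rewrite -(mem_rot i) E in ys => Py.
have : fpath (next s) x s'.
  have := cycle_next us; rewrite -(rot_cycle i) E /= rcons_path; by case/andP.
have sub : {subset x :: s' <= s} by move=> z; rewrite -E mem_rot.
elim: s' x Px ys sub {E xs} => [|z s' IH] x Px.
  by rewrite inE => /eqP E; rewrite E Px in Py.
move=> ys sub /= /andP[/eqP nx p].
have [Pz|nPz] := boolP (P z).
  apply: (IH z Pz _ _ p) => [|t tz]; last by apply: sub; rewrite inE tz orbT.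
  by move: ys; rewrite inE => /orP[/eqP E|//]; rewrite E Px in Py.
by exists x; rewrite ?Px ?nx ?nPz // sub ?inE ?eqxx.
Qed.

(** * Weighted distances and eccentricities *)

Lemma bigmin_head_mem (R : realType) (s : seq R) : s != [::] ->
  \big[Num.min/head 0 s]_(x <- s) x \in s.
Proof.
have gen (x0 : R) r : \big[Num.min/x0]_(x <- r) x \in x0 :: r.
  elim: r => [|y r IH]; first by rewrite big_nil mem_head.
  rewrite big_cons minEle; case: ifP => _; first by rewrite !inE eqxx orbT.
  by move: IH; rewrite !inE => /orP[->//|->]; rewrite !orbT.
case: s => // y s _; have := gen y (y :: s).
by rewrite /= !inE orbA orbb.
Qed.

Section Distances.

Variables (R : realType) (V : finType) (e : rel V) (w : {set V} -> R).
Hypotheses (e_tree : tree e) (w_ge0 : weight_function e w).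

Lemma wdist_attained u v :
  exists p, [/\ path e u p, last u p = v, uniq (u :: p)
              & wdist e w u v = path_weight w u p].
Proof.
rewrite /wdist; set ws := [seq _ | _ in _].
have ws0 : ws != [::].
  have /connectP[p0 pp0 vE] : connect e u v by case: e_tree.
  move: pp0 vE => /shortenP[p pp up _] vE.
  have sp : (size p <= #|V|)%N.
    by apply: ltnW; rewrite -[(size p).+1]/(size (u :: p)) -(card_uniqP up) max_card.
  have : path_weight w u (Bseq sp) \in ws.
    by apply: image_f; rewrite inE /= pp -vE eqxx.
  by case: ws.
have /mapP[p] := bigmin_head_mem ws0.
rewrite mem_enum inE => /and3P[pp /eqP lp up] ->.
by exists p.
Qed.

Lemma wdist_edge_le u v : e u v -> wdist e w u v <= w [set u; v].
Proof.
move=> euv; have V1 : (size [:: v] <= #|V|)%N by apply/card_gt0P; exists u.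
have uv : u != v by apply: edge_neq euv.
apply: (bigmin_inf_seq _ (path_weight w u (Bseq V1))) => //.
  by apply: image_f; rewrite inE /= euv eqxx inE uv.
by rewrite /path_weight /= big_seq1.
Qed.

Lemma path_edges u p f :
  path e u p -> f \in pairmap (fun x y => [set x; y]) u p -> f \in edges e.
Proof.
elim: p u => //= x p IH u /andP[eux px]; rewrite inE => /orP[/eqP->|]; last exact: IH.
exact: edge_in_edges.
Qed.

(** A list of edges weighs at least as much as the set of its members; repeated
    edges only add weight. *)
Lemma sum_mem_le (s : seq {set V}) : {subset s <= edges e} ->
  \sum_(f in edges e) w f * (f \in s)%:R <= \sum_(f <- s) w f.
Proof.
elim: s => [|g s IH] sub.
  by rewrite big_nil big1 // => f _; rewrite mulr0.
have ge : g \in edges e by apply: sub; rewrite mem_head.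
rewrite big_cons; apply: (le_trans (y := w g + \sum_(f in edges e) w f * (f \in s)%:R)).
  rewrite (bigD1 g) // [X in _ <= _ + X](bigD1 g) //= mem_head mulr1.
  rewrite lerD2l.
  apply: ler_wpDl; first by rewrite mulr_ge0 ?w_ge0.
  by apply: ler_sum => f /andP[_ /negPf fg]; rewrite inE fg.
by rewrite lerD2l; apply: IH => f fs; apply: sub; rewrite inE fs orbT.
Qed.

(** The distance between two vertices is at least the total weight of the edges
    that separate them. *)
Lemma wdist_ge_cut u v :
  \sum_(f in edges e) w f * (~~ connect (cut e f) u v)%:R <= wdist e w u v.
Proof.
have [p [pp lp _ ->]] := wdist_attained u v.
apply: le_trans (sum_mem_le (fun f => path_edges pp)).
apply: ler_sum => f fe; apply: ler_wpM2l; first exact: w_ge0.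
rewrite ler_nat; case: (boolP (connect _ _ _)) => //=.
by rewrite -lp => /(path_cross pp) ->.
Qed.

Lemma wdist_le_wecc v u : wdist e w u v <= wecc e w v.
Proof. exact: (le_bigmax (wdist e w v v) (wdist e w ^~ v)). Qed.

(** Every edge separates [v] from at least one leaf. *)
Lemma sum_wdist_leaves_ge v :
  \sum_(f in edges e) w f <= \sum_(l in end_vertices e) wdist e w l v.
Proof.
apply: le_trans (ler_sum _ (fun l _ => wdist_ge_cut l v)).
rewrite exchange_big /=; apply: ler_sum => f fe.
rewrite -mulr_sumr ler_peMr ?w_ge0 //.
have [l ll nc] := edge_separates_from e_tree v fe.
by rewrite (bigD1 l) //= (cut_sym e_tree) nc ler_wpDr // sumr_ge0.
Qed.

(** Bound the eccentricity of each leaf [l] by its distance from the next leaf in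
    a cyclic order of the leaves; every edge is counted at least twice. *)
Lemma sum_wecc_leaves_ge :
  2 * \sum_(f in edges e) w f <= \sum_(l in end_vertices e) wecc e w l.
Proof.
pose s := enum (end_vertices e).
have us : uniq s by apply: enum_uniq.
apply: le_trans (ler_sum _ (fun l _ => wdist_le_wecc l (next s l))).
apply: le_trans (ler_sum _ (fun l _ => wdist_ge_cut (next s l) l)).
rewrite exchange_big mulr_sumr /=; apply: ler_sum => f fe.
rewrite -mulr_sumr mulrC; apply: ler_wpM2l; first exact: w_ge0.
have [a [b [al bl nab]]] := edge_separates e_tree fe.
have cs := cut_sym e_tree f.
(* z is the last leaf before the cycle leaves the side of a, and y the last one
   before it comes back. *)
pose P := connect (cut e f) a.
have as_ : a \in s by rewrite mem_enum.
have bs : b \in s by rewrite mem_enum.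
have [z zs /andP[Pz nz]] := @exit_next _ s P a b us as_ bs (connect0 _ _) nab.
have nPa : ~~ ~~ P a by rewrite negbK /P connect0.
have [y ys /andP[/= ny Py]] := @exit_next _ s (predC P) b a us bs as_ nab nPa.
rewrite negbK in Py.
have zy : z != y by apply: contraNneq ny => <-.
rewrite !mem_enum in zs ys.
rewrite (bigD1 z) //= (bigD1 y) /=; last by rewrite ys eq_sym zy.
have -> : ~~ connect (cut e f) (next s z) z.
  rewrite cs.   by apply: contra nz; apply: connect_trans.
have -> : ~~ connect (cut e f) (next s y) y.
  by apply: contra ny; apply: connect_trans.
by rewrite addrA -[X in X <= _]addr0 lerD ?sumr_ge0.
Qed.

(** If the weight of each edge is at most the sum of the charges [h] of its
    endpoints, and only leaves are charged, then a simple path weighs at most the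
    charges of its two ends, as its interior vertices are not leaves. *)
Lemma path_weight_le (h : V -> R) :
  (forall x, 0 <= h x) -> (forall x, x \notin end_vertices e -> h x = 0) ->
  (forall x y, e x y -> w [set x; y] <= h x + h y) ->
  forall u p, path e u p -> uniq (u :: p) -> path_weight w u p <= h u + h (last u p).
Proof.
move=> h0 hz hw u p; rewrite /path_weight.
elim: p u => [|x p IH] u /=; first by rewrite big_nil addr_ge0.
case/andP=> eux px /andP[ux up]; rewrite big_cons.
case: p IH px ux up => [|y p] IH px ux up; first by rewrite big_nil addr0 hw.
have /hz hx : x \notin end_vertices e.
  have exu : e x u by case: e_tree => [[-> _] _ _].
  have exy : e x y by case/andP: px.
  apply/negP => /leaf_neighbour/(_ exu exy) E.
  by move: ux; rewrite E !inE eqxx orbT.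
have := hw _ _ eux; have := IH _ px up; rewrite hx add0r addr0 => A B.
exact: lerD.
Qed.

Lemma wecc_le v b : (forall u, wdist e w u v <= b) -> wecc e w v <= b.
Proof. by move=> le; apply: bigmax_le. Qed.

End Distances.

(** * The average eccentricity of a weighted tree *)

Theorem theorem3p1 (R : realType) (V : finType) (e : rel V) (w : {set V} -> R)
    (n t : nat)
    (e_tree : tree e)
    (card_V : #|V| = n)
    (n_ge3 : (3 <= n)%N)
    (card_end : #|end_vertices e| = t)
    (w_weight : weight_function e w)
    (w_norm : normalised e w) :
  (n%:R - 1) * (n%:R + t%:R) / (n%:R * t%:R) <= avec e w
  /\ (avec e w = (n%:R - 1) * (n%:R + t%:R) / (n%:R * t%:R) <->
      (forall f, f \in end_edges e -> w f = (n%:R - 1) / t%:R) /\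
      (forall f, f \in edges e :\: end_edges e -> w f = 0)).
Proof.
set L := end_vertices e; set W : R := n%:R - 1; set c : R := W / t%:R.
have V3 : (3 <= #|V|)%N by rewrite card_V.
have n_gt0 : 0 < n%:R :> R by rewrite ltr0n; apply: leq_trans n_ge3.
have sumW : \sum_(f in edges e) w f = W.
  by rewrite w_norm (card_edges e_tree) card_V -subn1 natrB //; apply: leq_trans n_ge3.
have t_gt0 : 0 < t%:R :> R.
  have /card_gt0P[f fe] : (0 < #|edges e|)%N.
    by rewrite (card_edges e_tree) card_V -subn1 subn_gt0 (leq_trans _ n_ge3).
  have [l [_ [lL _ _]]] := edge_separates e_tree fe.
  by rewrite ltr0n -card_end; apply/card_gt0P; exists l.
have ct : t%:R * c = W by rewrite /c mulrC divfK // gt_eqF.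
have W_ge0 : 0 <= W by rewrite -sumW sumr_ge0.
have c_ge0 : 0 <= c by rewrite divr_ge0 // ltW.
have constL (a : R) : \sum_(l in L) a = t%:R * a.
  by rewrite sumr_const card_end mulr_natl.
have ecc_ge v : c <= wecc e w v.
  rewrite -(ler_pM2l t_gt0) ct -sumW.
  apply: le_trans (sum_wdist_leaves_ge e_tree w_weight v) _.
  by rewrite -constL; apply: ler_sum => l _; apply: wdist_le_wecc.
have leaves_ge : 2 * W <= \sum_(l in L) wecc e w l.
  by rewrite -sumW; apply: sum_wecc_leaves_ge.
have split_sum (F : V -> R) :
    \sum_v F v = \sum_(v in L) F v + \sum_(v in ~: L) F v.
  rewrite (bigID (mem L)) /=; congr (_ + _).
  by apply: eq_bigl => v; rewrite [RHS]inE.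
have constLC (a : R) : \sum_(v in ~: L) a = (n%:R - t%:R) * a.
  by rewrite sumr_const cardsCs setCK card_V card_end -[LHS]mulr_natl natrB //
     -card_V -card_end max_card.
have avecE : avec e w = W * (n%:R + t%:R) / (n%:R * t%:R) <->
    \sum_v wecc e w v = 2 * W + (n%:R - t%:R) * c.
  rewrite /avec card_V -ct; split=> [E|->].
    rewrite -[LHS](mulVKf (lt0r_neq0 n_gt0)) E /c; field.
    by rewrite !gt_eqF.
  by field; rewrite !gt_eqF.
have inner_ge : (n%:R - t%:R) * c <= \sum_(v in ~: L) wecc e w v.
  by rewrite -constLC; apply: ler_sum.
have sum_ge : 2 * W + (n%:R - t%:R) * c <= \sum_v wecc e w v.
  by rewrite split_sum lerD.
split.
  rewrite /avec card_V (_ : W * _ / _ = n%:R^-1 * (2 * W + (n%:R - t%:R) * c)).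
    by rewrite ler_pM2l // invr_gt0.
  by rewrite -ct /c; field; rewrite !gt_eqF.
rewrite avecE; split.
- move=> E; have inner_eq : \sum_(v in ~: L) (wecc e w v - c) = 0.
    rewrite sumrB constLC; rewrite split_sum in E.
    by apply: le_anti; rewrite subr_ge0 inner_ge andbT; lra.
  have wecc_inner v : v \notin L -> wecc e w v = c.
    move=> vL; apply/eqP; rewrite -subr_eq0; apply/eqP.
    apply: (psumr_eq0P _ inner_eq); last by rewrite inE.
    by move=> u _; rewrite subr_ge0.
  have end_ge l u : l \in L -> e l u -> c <= w [set l; u].
    move=> lL elu; apply: le_trans _ (wdist_edge_le w e_tree elu).
    (* The t distances from the leaves to u are at most c and add up to at
       least t c; dropping the one from l leaves at least c for it. *)
    have uc := wecc_inner u (neighbour_of_leaf e_tree V3 lL elu).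
    have S := sum_wdist_leaves_ge e_tree w_weight u.
    rewrite sumW -ct -constL (bigD1 l) // [X in _ <= X](bigD1 l) //= in S.
    rewrite -(lerD2r (\sum_(i in L | i != l) c)); apply: le_trans S _.
    by rewrite lerD2l; apply: ler_sum => i _; rewrite -uc wdist_le_wecc.
  have end_edges_ge f : f \in end_edges e -> c <= w f.
    rewrite inE => /andP[/edgesP[x [y [exy ->]]] /exists_inP[l lL]].
    case: e_tree => [[e_sym _] _ _]; rewrite !inE => /orP[]/eqP lE.
      by apply: end_ge; rewrite -?lE // in lL *; rewrite lE.
    by rewrite setUC; apply: end_ge; rewrite -lE // lE e_sym.
  have card_end_edges : (t <= #|end_edges e|)%N.
    (* Distinct leaves have distinct end edges, as no two leaves are adjacent. *)
    pose nb l := odflt l [pick u | e l u].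
    have nbP l : l \in L -> e l (nb l).
      move=> /leaf_edge[u elu]; rewrite /nb; case: pickP => // /(_ u).
      by rewrite elu.
    rewrite -card_end -(card_in_imset (f := fun l => [set l; nb l])).
      apply: subset_leq_card; apply/subsetP => f /imsetP[l lL ->].
      rewrite inE edge_in_edges ?nbP //; apply/exists_inP; exists l => //.
      by rewrite !inE eqxx.
    move=> l k lL kL /setP/(_ l); rewrite !inE eqxx => /esym/orP[/eqP//|/eqP lE].
    by have := neighbour_of_leaf e_tree V3 kL (nbP k kL); rewrite -lE lL.
  (* The weights dominate b, whose total is at least W: they agree with b. *)
  pose b f := if f \in end_edges e then c else 0.
  have b_le f : f \in edges e -> 0 <= w f - b f.
    rewrite subr_ge0 /b => fe; case: ifP => [/end_edges_ge//|_]; exact: w_weight.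
  have tight f : f \in edges e -> w f = b f.
    move=> fe; apply/eqP; rewrite -subr_eq0; apply/eqP.
    apply: (psumr_eq0P b_le) fe; apply: le_anti; rewrite sumr_ge0 // andbT.
    rewrite sumrB sumW subr_le0 /b -big_mkcondr /=.
    rewrite (eq_bigl (mem (end_edges e))); last first.
      by move=> g; rewrite /= inE; case: (g \in edges e).
    by rewrite sumr_const -mulr_natl -ct ler_wpM2r // ler_nat.
  split=> f; first by move=> fE; rewrite tight /b ?fE //; case/setIdP: fE.
  by rewrite inE => /andP[/negPf fE fe]; rewrite tight // /b fE.
case=> w_end w_inner.
apply: le_anti; rewrite sum_ge andbT.
(* With the charge c on each leaf, the eccentricity of v is at most c + h v. *)
pose h v : R := if v \in L then c else 0.
have h_ge0 v : 0 <= h v by rewrite /h; case: ifP.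
have h_le v : h v <= c by rewrite /h; case: ifP.
have h_edge x y : e x y -> w [set x; y] <= h x + h y.
  move=> exy; have fe := edge_in_edges exy.
  have [fE|nfE] := boolP ([set x; y] \in end_edges e); last first.
    by rewrite w_inner ?addr_ge0 // inE nfE.
  rewrite w_end //; move: fE; rewrite inE fe => /exists_inP[l lL].
  have hl : h l = c by rewrite /h lL.
  by rewrite !inE => /orP[]/eqP <-; rewrite hl -/c ?lerDl ?lerDr.
have ecc_le v : wecc e w v <= c + h v.
  apply: wecc_le => u; have [p [pp <- up ->]] := wdist_attained w e_tree u v.
  apply: le_trans (path_weight_le e_tree h_ge0 _ h_edge pp up) _.
    by move=> x /negPf xL; rewrite /h xL.
  by rewrite lerD2r.
apply: le_trans (ler_sum _ (fun v _ => ecc_le v)) _.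
rewrite big_split /= -big_mkcond constL (split_sum (fun=> c)) constL constLC.
by rewrite ct; lra.
Qed.
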